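(* For all $\lambda, \nu > 0$, $$Z(\lambda,\nu) = \frac{1}{1-\lambda} + \frac{\nu}{\lambda-1}\int_1^\infty x^{-(\nu+1)}\,\lambda^{[\Gamma^{-1}(x)]}\,\mathrm{d}x,$$ where $\Gamma^{-1}$ stands for the increasing branch of the inverse of the Gamma function in the right half-plane, and $[y]$ denotes the integer part of a real number $y$.
   Context: For real $\lambda,\nu>0$, the COM--Poisson (Conway--Maxwell--Poisson) normalization constant is $$Z(\lambda,\nu) = \sum_{n=0}^\infty \frac{\lambda^n}{(n!)^\nu},$$ so that $\mathsf P(X=n) = \dfrac{\lambda^n}{Z(\lambda,\nu)\,(n!)^\nu}$, $n\in\{0,1,2,\dots\}$, is a probability distribution. Let $\alpha = 1.4616\cdots$ be the point at which the Gamma function $\Gamma$ attains its minimum on $(0,\infty)$. The function $\Gamma$ is strictly increasing on $[\alpha,\infty)$ and maps it onto $[\Gamma(\alpha),\infty)$, where $\Gamma(\alpha)<1$. The increasing branch $\Gamma^{-1}\colon[\Gamma(\alpha),\infty)\to[\alpha,\infty)$ is the inverse of this restriction. The integer part $[y]$ of a real number $y\ge 0$ is the greatest integer not exceeding $y$.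
   Formalization: The case λ = 1 is excluded, since there the terms 1/(1−λ) and ν/(λ−1) are undefined; the identity is stated for all λ, ν > 0 with λ ≠ 1. *)

(* Defs.v *)
From HB Require Import structures.
From mathcomp Require Import all_boot all_order all_algebra.
From mathcomp Require Import all_classical all_reals all_analysis.

Set Implicit Arguments.
Unset Strict Implicit.
Unset Printing Implicit Defensive.

Import Order.TTheory GRing.Theory Num.Theory.
Import numFieldNormedType.Exports.

Local Open Scope classical_set_scope.
Local Open Scope ring_scope.

Definition com_poisson_term (R : realType) (lam nu : R) : R^nat :=
  fun n => lam ^+ n / (n`!%:R `^ nu).

Definition com_poisson_Z (R : realType) (lam nu : R) : R :=
  limn (series (com_poisson_term lam nu)).

(* Euler's integral; meaningful for x > 0 only, since [Rintegral] is 0 when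
   the integral is infinite. *)
Definition Gamma (R : realType) (x : R) : R :=
  \int[@lebesgue_measure R]_(t in `]0, +oo[) (t `^ (x - 1) * expR (- t)).

Definition Gamma_argmin (R : realType) : R :=
  xget 0 [set a : R | 0 < a /\ forall x : R, 0 < x -> Gamma a <= Gamma x].

(* Increasing branch of the inverse: the inverse of the restriction of [Gamma]
   to [Gamma_argmin, +oo[.  Its values outside of the image of that half-line,
   i.e. below the minimum of [Gamma], are irrelevant. *)
Definition Gamma_inv (R : realType) : R -> R :=
  'pinv_(fun=> 0) `[Gamma_argmin R, +oo[ (@Gamma R).

(* Main.v *)
(* For [x] in [n!, (n+1)!), [x > 1], the point [y = Gamma_inv x] lies in
   [n+1, n+2), so that the integral over [1, +oo[ is
   [\sum_n lam^(n+1) (n!^-nu - (n+1)!^-nu) / nu], which telescopes to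
   [(lam Z - (Z - 1)) / nu].  Locating [y] only takes the convexity of [Gamma],
   its values [Gamma (n+1) = n!], and [Gamma a <= 1] at the minimum [a]. *)
Require Import Defs.
From HB Require Import structures.
From mathcomp Require Import all_boot all_order all_algebra.
From mathcomp Require Import all_classical all_reals all_analysis.
From mathcomp Require Import measurable_realfun ring lra.

Set Implicit Arguments.
Unset Strict Implicit.
Unset Printing Implicit Defensive.

Import Order.TTheory GRing.Theory Num.Theory.
Import numFieldNormedType.Exports.

Local Open Scope classical_set_scope.
Local Open Scope ring_scope.

(** * Integrals of real powers over bounded intervals *)

Section powR_integral.
Context {R : realType}.
Notation mu := (@lebesgue_measure R).

Lemma continuous_powR (p x : R) : 0 < x -> {for x, continuous (@powR R ^~ p)}.
Proof.
move=> x0; apply/differentiable_continuous/derivable1_diffP.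
by apply: derivable_powR; rewrite in_itv/= x0.
Qed.

Lemma within_continuous_powR (p a b : R) : 0 < a ->
  {within `[a, b], continuous (@powR R ^~ p)}.
Proof.
move=> a0; apply: continuous_in_subspaceT => x; rewrite inE/= in_itv/= => /andP[ax _].
by apply: continuous_powR; exact: lt_le_trans ax.
Qed.

Lemma integral_powR (p a b : R) : p != 0 -> 0 < a -> a <= b ->
  (\int[mu]_(x in `[a, b]) (x `^ (p - 1))%:E = ((b `^ p - a `^ p) / p)%:E)%E.
Proof.
move=> p0 a0; rewrite le_eqVlt => /predU1P[->|ab].
  by rewrite set_itv1 integral_set1 subrr mul0r.
have H (x : R) : 0 < x -> is_derive x 1 (fun x : R => x `^ p / p) (x `^ (p - 1)).
  move=> x0; rewrite (_ : (fun _ => _) =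
    p^-1 \*: ((@powR R ^~ p) : R -> R^o)); last first.
    by apply/funext => y /=; rewrite mulrC.
  apply: is_derive_eq; first by apply: is_deriveZ; apply: is_derive1_powR.
  by rewrite /GRing.scale/= mulKf.
rewrite (@continuous_FTC2 _ _ (fun x => x `^ p / p)) //.
- by rewrite -EFinB mulrBl.
- exact: within_continuous_powR.
- split.
  + by move=> x; rewrite in_itv/= => /andP[ax _]; apply: ex_derive; apply: H; lra.
  + apply: cvg_at_right_filter; apply: cvgMr_tmp; exact: continuous_powR.
  + apply: cvg_at_left_filter; apply: cvgMr_tmp; apply: continuous_powR; lra.
- move=> x; rewrite in_itv/= => /andP[ax _].
  by rewrite derive1E; apply: derive_val; apply: H; lra.
Qed.

(** Monotone convergence along the intervals [1/(n+1), 1], on which the integral is (1 - (n+1)^-p) /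
    p and so at most 1/p. *)
Lemma integral_powR01_lty (p : R) : 0 < p ->
  (\int[mu]_(x in `]0%R, 1%R]) (x `^ (p - 1))%:E < +oo)%E.
Proof.
move=> p0; pose F n : set R := `[n.+1%:R^-1, 1]%classic.
have UF : `]0, 1]%classic = \bigcup_n F n.
  apply/seteqP; split=> x /=.
    rewrite in_itv/= => /andP[x0 x1]; exists (Num.truncn x^-1) => //=.
    rewrite /F/= in_itv/= x1 andbT invf_ple ?posrE//; exact/ltW/truncnS_gt.
  move=> [n _]; rewrite /F/= !in_itv/= => /andP[nx ->].
  by rewrite andbT (lt_le_trans _ nx).
have mF : forall i, measurable (F i) by move=> i; exact: measurable_itv.
have ndF : nondecreasing_seq F.
  move=> m n mn; apply/subsetPset => x; rewrite /F/= !in_itv/= => /andP[mx ->].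
  by rewrite andbT (le_trans _ mx)// lef_pV2 ?posrE// ler_nat.
have mpow i : measurable_fun (F i) (fun x => (x `^ (p - 1))%:E).
  apply/measurable_EFinP; apply: measurable_funTS; exact: measurable_powR.
have pow_ge0 i x : F i x -> (0 <= (x `^ (p - 1))%:E)%E.
  by move=> _; rewrite lee_fin powR_ge0.
have /cvg_lim <- // : (\int[mu]_(x in F i) (x `^ (p - 1))%:E)%E @[i --> \oo] -->
    (\int[mu]_(x in `]0%R, 1%R]) (x `^ (p - 1))%:E)%E.
  by rewrite UF; exact: ge0_nondecreasing_set_cvg_integral.
apply: (@le_lt_trans _ _ (p^-1)%:E); last exact: ltry.
apply: lime_le.
  apply: ereal_nondecreasing_is_cvgn.
  exact: ge0_nondecreasing_set_nondecreasing_integral.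
apply: nearW => n; rewrite integral_powR ?gt_eqF ?invr_gt0//; last first.
  by rewrite invf_ple ?posrE// invr1 ler1n.
by rewrite lee_fin powR1 ler_pdivrMr// mulVf ?gt_eqF// gerBl powR_ge0.
Qed.

End powR_integral.

(** * Euler's integral at positive integers *)

Section gamma_nat.
Context {R : realType}.
Notation mu := (@lebesgue_measure R).

(** One more term of the exponential series suffices: exp t >= t^(n+1) / (n+1)! bounds the function
    by (n+1)! / t. *)
Lemma cvgy_expX_expRN n : (t : R) ^+ n * expR (- t) @[t --> +oo] --> (0 : R).
Proof.
have : (n.+1`!%:R : R) * t^-1 @[t --> +oo] --> (0 : R).
  rewrite -[X in _ --> X](mulr0 (n.+1`!%:R : R)); apply: cvgMl_tmp.
  by apply/gtr0_cvgV0; [exact: nbhs_pinfty_gt | exact: cvg_id].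
apply: (@squeeze_cvgr _ _ _ _ (fun=> 0)); last exact: cvg_cst.
near=> t; have t0 : 0 < t by near: t; exact: nbhs_pinfty_gt.
rewrite mulr_ge0 ?exprn_ge0 ?expR_ge0 ?(ltW t0)//=.
have := expR_ge1Dxn n (ltW t0); rewrite expRN => h.
rewrite ler_pdivrMr ?expR_gt0// mulrAC ler_pdivlMr// -exprSr mulrC -ler_pdivrMr.
  by apply: le_trans h; rewrite lerDr.
by rewrite ltr0n fact_gt0.
Unshelve. all: end_near. Qed.

(** Integration by parts at the level of primitives: if F serves for n, then (n+1) F(t) - t^(n+1)
    exp(-t) serves for n+1. The boundary values at 0 and at infinity then give the integral. *)
Lemma gamma_primitive n : exists F : R -> R,
  [/\ forall t : R, is_derive t 1 F (t ^+ n * expR (- t)),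
      F 0 = - n`!%:R & F t @[t --> +oo] --> (0 : R)].
Proof.
have dE (t : R) : is_derive t 1 (fun t : R => expR (- t)) (- expR (- t)).
  by rewrite -mulrN1; apply: (@is_derive1_comp _ expR (fun x : R => - x)).
elim: n => [|n [F [dF F0 Fy]]].
  exists (fun t => - expR (- t)); split.
  - move=> t; have := is_deriveN (dE t).
    by rewrite opprK expr0 mul1r.
  - by rewrite oppr0 expR0.
  - by rewrite -oppr0; apply: cvgN; exact: cvgr_expR.
exists (fun t => n.+1%:R * F t - t ^+ n.+1 * expR (- t)); split.
- move=> t; rewrite (_ : (fun _ => _) =
    (n.+1%:R \*: F) - (id ^+ n.+1) * (fun t : R => expR (- t))); last first.
    by apply/funext => x; rewrite !fctE.
  apply: is_derive_eq.
  rewrite /GRing.scale/= !fctE.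
  ring.
- by rewrite F0 expr0n mul0r subr0 mulrN -natrM.
- rewrite -[X in _ --> X](subr0 (0 : R)); apply: cvgB; last exact: cvgy_expX_expRN.
  by rewrite -[X in _ --> X](mulr0 (n.+1%:R : R)); apply: cvgMl_tmp.
Qed.

Lemma integral_expX_expRN n :
  (\int[mu]_(t in `]0%R, +oo[) (t ^+ n * expR (- t))%:E = (n`!%:R)%:E)%E.
Proof.
have [F [dF F0 Fy]] := gamma_primitive n.
have cg : continuous (fun t : R => t ^+ n * expR (- t)).
  move=> t; apply: cvgM; first exact: exprn_continuous.
  apply: (@continuous_comp _ _ _ -%R expR); first exact: opp_continuous.
  exact: continuous_expR.
rewrite integral_itv_obnd_cbnd; last first.
  apply/measurable_EFinP; apply: measurable_funTS.
  exact: continuous_measurable_fun.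
rewrite (@ge0_continuous_FTC2y _ _ F 0 0)//.
- by rewrite F0 sub0e EFinN oppeK.
- by move=> x x0; rewrite mulr_ge0 ?exprn_ge0 ?expR_ge0.
- exact: continuous_subspaceT.
- apply: cvg_at_right_filter.
  by apply/differentiable_continuous/derivable1_diffP/ex_derive.
- by move=> x _; rewrite derive1E; apply: derive_val.
Qed.

End gamma_nat.

(** * Convexity, continuity, minimum and inverse of [Gamma] *)

Section Gamma_theory.
Context {R : realType}.
Notation mu := (@lebesgue_measure R).
Implicit Types x y z t : R.

Lemma measurable_gamma_integrand x (D : set R) :
  measurable_fun D (fun t => t `^ (x - 1) * expR (- t)).
Proof.
apply: measurable_funTS; apply: measurable_funM; first exact: measurable_powR.
exact: measurableT_comp.
Qed.

Lemma gamma_integrand_ge0 x t : 0 <= t `^ (x - 1) * expR (- t).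
Proof. by rewrite mulr_ge0 ?powR_ge0 ?expR_ge0. Qed.

(** The integral is split at 1: the factor exp(-t) is at most 1 to the left, and the power of t is
    dominated by an integer power to the right. *)
Lemma gamma_integral_lty x : 0 < x ->
  (\int[mu]_(t in `]0%R, +oo[) (t `^ (x - 1) * expR (- t))%:E < +oo)%E.
Proof.
move=> x0.
have -> : `]0%R, +oo[%classic = (`]0, 1] `|` `]1, +oo[)%classic :> set R.
  by rewrite -itv_bndbnd_setU// bnd_simp.
have mf D : measurable_fun D (fun t => (t `^ (x - 1) * expR (- t))%:E).
  by apply/measurable_EFinP; exact: measurable_gamma_integrand.
rewrite ge0_integral_setU//=; last 3 first.
- exact: mf.
- by move=> t _; rewrite lee_fin gamma_integrand_ge0.
- apply/disj_setPRL => t /=; rewrite !in_itv/= => /andP[t1 _] /andP[_].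
  by rewrite leNgt t1.
rewrite lte_add_pinfty//.
  apply: le_lt_trans (integral_powR01_lty x0).
  apply: ge0_le_integral => //=.
  - by move=> t _; rewrite lee_fin gamma_integrand_ge0.
  - exact: mf.
  - by apply/measurable_EFinP; apply: measurable_funTS; exact: measurable_powR.
  - move=> t; rewrite in_itv/= => /andP[t0 t1].
    rewrite lee_fin ler_piMr ?powR_ge0// -expR0 ler_expR; lra.
(* Since x < n + 1, the exponent x - 1 is at most n. *)
pose n := Num.truncn x.
apply: (@le_lt_trans _ _
  (\int[mu]_(t in `]0%R, +oo[) (t ^+ n * expR (- t))%:E)%E); last first.
  by rewrite integral_expX_expRN ltry.
have mg D : measurable_fun D (fun t : R => (t ^+ n * expR (- t))%:E).
  apply/measurable_EFinP; apply: measurable_funTS; apply: measurable_funM.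
    exact: exprn_measurable.
  exact: measurableT_comp.
apply: (@le_trans _ _
  (\int[mu]_(t in `]1%R, +oo[) (t ^+ n * expR (- t))%:E)%E).
  apply: ge0_le_integral => //=.
  - by move=> t _; rewrite lee_fin gamma_integrand_ge0.
  - exact: mf.
  - exact: mg.
  - move=> t; rewrite in_itv/= andbT => t1.
    rewrite lee_fin ler_pM2r ?expR_gt0// -powR_mulrn; last lra.
    by apply: ler_powR; [lra|rewrite lerBlDr natr1; exact/ltW/truncnS_gt].
apply: ge0_subset_integral => //=.
- exact: mg.
- move=> t; rewrite in_itv/= andbT => t0.
  by rewrite lee_fin mulr_ge0 ?expR_ge0// exprn_ge0// ltW.
- by move=> t /=; rewrite !in_itv/= !andbT; apply: lt_trans.
Qed.

Lemma integrable_gamma_integrand x : 0 < x ->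
  mu.-integrable `]0, +oo[ (EFin \o fun t => t `^ (x - 1) * expR (- t)).
Proof.
move=> x0; apply/integrableP; split.
  by apply/measurable_EFinP; exact: measurable_gamma_integrand.
under eq_integral do rewrite /= ger0_norm ?gamma_integrand_ge0//.
exact: gamma_integral_lty.
Qed.

Lemma Gamma_fact n : Gamma (n.+1%:R : R) = n`!%:R.
Proof.
rewrite /Gamma /Rintegral -[RHS]/(fine (n`!%:R)%:E) -integral_expX_expRN.
congr fine; apply: eq_integral => t; rewrite inE/= in_itv/= andbT => t0.
by rewrite -natr1 addrK powR_mulrn// ltW.
Qed.

Lemma Gamma1 : Gamma (1 : R) = 1.
Proof. by rewrite (Gamma_fact 0). Qed.

Lemma Gamma2 : Gamma (2 : R) = 1.
Proof. by rewrite (Gamma_fact 1). Qed.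

(** The inequality holds for the integrand at each t. The form without denominators also covers
    coinciding points. *)
Lemma Gamma_convex x y z : 0 < x -> x <= y -> y <= z ->
  (z - x) * Gamma y <= (z - y) * Gamma x + (y - x) * Gamma z.
Proof.
move=> x0 xy yz.
have [y0 z0] : 0 < y /\ 0 < z by split; lra.
have Z c u : 0 < u -> mu.-integrable `]0, +oo[
    (EFin \o fun t => c * (t `^ (u - 1) * expR (- t))).
  by move=> u0; apply: (integrableZl _ c (integrable_gamma_integrand u0)).
rewrite /Gamma -!RintegralZl//; try exact: integrable_gamma_integrand.
rewrite -RintegralD//; try exact: Z.
apply: le_Rintegral => //; first exact: Z.
  by apply: (integrableD _ (Z (z - y) x x0) (Z (y - x) z z0)).
move=> t /=; rewrite in_itv/= andbT => t0.
rewrite !mulrA -mulrDl ler_pM2r ?expR_gt0//.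
rewrite /powR gt_eqF//.
(* Factoring out t^(y-1) moves the point of tangency to exponent 0, where the tangent bound is exp s
   >= 1 + s. *)
have E u : expR ((u - 1) * ln t) = expR ((u - y) * ln t) * expR ((y - 1) * ln t).
  by rewrite -expRD; congr expR; ring.
rewrite (E x) (E z) !mulrA -mulrDl ler_pM2r ?expR_gt0//.
(* The convex function [u |-> t `^ (u - 1)] lies above its tangent at [y]. *)
have h1 := expR_ge1Dx ((x - y) * ln t).
have h2 := expR_ge1Dx ((z - y) * ln t).
have zy : 0 <= z - y by lra.
have yx : 0 <= y - x by lra.
have := ler_wpM2l zy h1; have := ler_wpM2l yx h2; lra.
Qed.

(** Outside [1, 2] a convex function lies above its secant through 1 and 2, here the constant 1.
    With [Gamma_ge1r], this confines the search for a minimum to [1, 2]. *)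
Lemma Gamma_ge1l x : 0 < x -> x <= 1 -> 1 <= Gamma x.
Proof.
move=> x0 x1; have := Gamma_convex x0 x1 (ler1n _ 2); rewrite Gamma1 Gamma2; lra.
Qed.

Lemma Gamma_ge1r x : 2 <= x -> 1 <= Gamma x.
Proof.
move=> x2; have := Gamma_convex ltr01 (ler1n _ 2) x2; rewrite Gamma1 Gamma2; lra.
Qed.

(** Dominated convergence for parameters in ]x/2, x+1[: the integrand is below its value at u = x/2
    when t <= 1 and at v = x+1 when t >= 1, hence always below the sum of the two. *)
Lemma Gamma_continuous x : 0 < x -> {for x, continuous (@Gamma R)}.
Proof.
move=> x0.
pose f y t := t `^ (y - 1) * expR (- t).
pose u := x / 2; pose v := x + 1.
have u0 : 0 < u by rewrite divr_gt0.
have v0 : 0 < v by rewrite addr_gt0.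
have xuv : x \in `]u, v[%classic.
  by rewrite inE/= in_itv/= /u /v; apply/andP; split; lra.
apply: (@continuity_under_integral R _ _ mu f `]0%R, +oo[ _ u v _ _
  (fun t => f u t + f v t)) => //.
- move=> y /=; rewrite in_itv/= => /andP[uy _].
  apply: integrable_gamma_integrand; lra.
- apply: aeW => t /=; rewrite in_itv/= andbT => t0 y _.
  apply: cvgMr_tmp; rewrite /powR gt_eqF//.
  apply: (@continuous_comp _ _ _ (fun y => (y - 1) * ln t) expR);
    last exact: continuous_expR.
  apply: cvgMr_tmp; apply: cvgB; [exact: cvg_id|exact: cvg_cst].
- by apply: (integrableD _ (integrable_gamma_integrand u0)
    (integrable_gamma_integrand v0)).
- move=> y /=; rewrite in_itv/= => /andP[uy yv]; apply: aeW => t /=.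
  rewrite in_itv/= andbT => t0.
  rewrite ger0_norm ?gamma_integrand_ge0// /f -mulrDl ler_pM2r ?expR_gt0//.
  have [t1|/ltW t1] := leP t 1.
    rewrite ler_wpDr ?powR_ge0//; apply: ger_powR; [by rewrite t0|lra].
  by rewrite ler_wpDl ?powR_ge0//; apply: ler_powR => //; lra.
Qed.

(** The minimum on the compact [1, 2] is at most [Gamma 1], that is 1, and hence global; so [xget]
    does not return its default. *)
Lemma Gamma_argminP :
  0 < Gamma_argmin R /\ forall x, 0 < x -> Gamma (Gamma_argmin R) <= Gamma x.
Proof.
suff [a ha] : exists a : R, 0 < a /\ forall x, 0 < x -> Gamma a <= Gamma x.
  exact: (@xgetPex _ 0 [set a : R | 0 < a /\ forall x, 0 < x -> Gamma a <= Gamma x]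
    (ex_intro _ a ha)).
have cG : {within `[1, 2], continuous (@Gamma R)}.
  apply: continuous_in_subspaceT => x; rewrite inE/= in_itv/= => /andP[x1 _].
  by apply: Gamma_continuous; lra.
have [|c] := EVT_min _ cG; first lra.
rewrite in_itv/= => /andP[c1 c2] cm.
have Gc : Gamma c <= 1 by rewrite -Gamma1; apply: cm; rewrite in_itv/=; lra.
exists c; split; first exact: lt_le_trans c1.
move=> x x0; have [x1|x1] := leP x 1; first exact: le_trans (Gamma_ge1l x0 x1).
have [x2|x2] := leP x 2; first by apply: cm; rewrite in_itv/= x2 ltW.
exact: le_trans (Gamma_ge1r (ltW x2)).
Qed.

(** A partial inverse is a right inverse on the image, so it is enough to reach x from the half-line
    by the intermediate value theorem. *)
Lemma Gamma_invP x : 1 <= x ->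
  Gamma_argmin R <= Gamma_inv x /\ Gamma (Gamma_inv x) = x.
Proof.
move=> x1; set a := Gamma_argmin R.
have [a0 am] := Gamma_argminP; rewrite -/a in a0 am.
have xim : [set Gamma y | y in `[a, +oo[%classic] x.
  have Ga : Gamma a <= x.
    by apply: le_trans x1; rewrite -Gamma1; exact: am.
  (* Large enough that n+1 lies to the right of a and that [Gamma] takes there a value n! >= n >=
     x. *)
  pose n := (Num.truncn a + Num.truncn x).+1.
  have [an xn] : a <= n.+1%:R /\ x <= n`!%:R.
    split.
      by rewrite (le_trans (ltW (truncnS_gt a)))// ler_nat ltnS ltnW// ltnS leq_addr.
    rewrite (le_trans (ltW (truncnS_gt x)))// ler_nat.
    apply: (@leq_trans n); first by rewrite ltnS leq_addl.
    exact: fact_geq.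
  have cG : {within `[a, n.+1%:R], continuous (@Gamma R)}.
    apply: continuous_in_subspaceT => y; rewrite inE/= in_itv/= => /andP[ay _].
    by apply: Gamma_continuous; lra.
  have [|y] := IVT an cG (v := x).
    by rewrite ge_min Ga le_max Gamma_fact xn orbT.
  rewrite in_itv/= => /andP[ay _] yx.
  by exists y => //=; rewrite in_itv/= ay.
split; last by rewrite /Gamma_inv; apply: pinvK; rewrite inE.
have : `[a, +oo[%classic (Gamma_inv x).
  apply: (@surjpinv_image_sub _ _ (fun=> 0) `[a, +oo[%classic
    [set Gamma y | y in `[a, +oo[%classic] (@Gamma R)) => //.
  by exists x.
by rewrite /= in_itv/= andbT.
Qed.

Lemma floor_Gamma_inv n x : 1 < x -> n`!%:R <= x < n.+1`!%:R ->
  Num.floor (Gamma_inv x) = n.+1.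
Proof.
move=> x1 /andP[nx xn].
have [ay yx] := Gamma_invP (ltW x1).
have [a0 am] := Gamma_argminP.
have Ga1 : Gamma (Gamma_argmin R) <= 1 by rewrite -Gamma1; exact: am.
set y := Gamma_inv x in ay yx *; set a := Gamma_argmin R in ay a0 am Ga1.
apply: floor_def; apply/andP; split.
(* If a <= y < n+1, convexity bounds x = Gamma y by an average of Gamma a < x, with positive weight,
   and n! <= x: a contradiction. *)
- rewrite leNgt; apply/negP => h; have {}h : y < n.+1%:R by rewrite pmulrn.
  have := Gamma_convex a0 ay (ltW h); rewrite yx Gamma_fact => hc.
  have h1 : (n.+1%:R - y) * Gamma a < (n.+1%:R - y) * x 
    by rewrite ltr_pM2l ?subr_gt0//; exact: le_lt_trans x1.
  have h2 : (y - a) * n`!%:R <= (y - a) * x by rewrite ler_wpM2l// subr_ge0.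
  move: hc h1 h2; clear; lra.
(* If 1 < n+2 <= y, convexity bounds (n+1)! by an average of Gamma 1 = 1 and Gamma y = x, so by x: a
   contradiction. *)
- rewrite ltNge; apply/negP => h; have {}h : n.+2%:R <= y.
    by move: h; rewrite intrD -natr1.
  have n2 : 1 <= n.+2%:R :> R by rewrite ler1n.
  have := Gamma_convex ltr01 n2 h; rewrite yx Gamma_fact Gamma1 => hc.
  have h1 : (y - n.+2%:R) * 1 <= (y - n.+2%:R) * x
    by rewrite ler_wpM2l ?subr_ge0// ltW.
  have h2 : (y - 1) * x < (y - 1) * n.+1`!%:R.
    by rewrite ltr_pM2l// subr_gt0 (lt_le_trans _ h)// ltr1n.
  move: hc h1 h2; clear; lra.
Qed.

End Gamma_theory.

(** * Convergence and telescoping of the COM-Poisson series *)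

Section com_poisson_series.
Context {R : realType}.
Implicit Types lam nu : R.

Lemma com_poisson_term_ge0 lam nu n : 0 < lam -> 0 <= com_poisson_term lam nu n.
Proof. by move=> l0; rewrite divr_ge0 ?powR_ge0// exprn_ge0// ltW. Qed.

(* With [x := (2 lam)^(1/nu)], the bound [x^n / n! <= exp x] raised to the
   power [nu] compares the series with a geometric one of ratio [1/2]. *)
Lemma is_cvg_com_poisson lam nu : 0 < lam -> 0 < nu ->
  cvgn (series (com_poisson_term lam nu)).
Proof.
move=> l0 nu0; pose x := (2 * lam) `^ nu^-1.
have x0 : 0 <= x by exact: powR_ge0.
have hC : 0 <= expR x `^ nu by exact: powR_ge0.
apply: (@series_le_cvg _ _ (geometric (expR x `^ nu) 2^-1)).
- by move=> n; exact: com_poisson_term_ge0.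
- by move=> n /=; rewrite mulr_ge0// exprn_ge0// invr_ge0.
- move=> n; rewrite /com_poisson_term /=.
  have fn : 0 < (n`!%:R : R) by rewrite ltr0n fact_gt0.
  have xn : x ^+ n <= expR x * n`!%:R.
    rewrite -ler_pdivrMr//; case: n {fn} => [|n].
      by rewrite expr0 divr1 -expR0 ler_expR.
    by apply: le_trans (expR_ge1Dxn n x0); rewrite lerDr.
  have : (x ^+ n) `^ nu <= (expR x * n`!%:R) `^ nu.
    by apply: ge0_ler_powR => //; rewrite ?nnegrE ?exprn_ge0 ?mulr_ge0 ?expR_ge0// ltW.
  have l2 : 0 <= 2 * lam by rewrite mulr_ge0// ltW.
  have -> : (x ^+ n) `^ nu = (2 * lam) ^+ n.
    rewrite -powR_mulrn// powRAC powR_mulrn ?powR_ge0//.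
    by rewrite -powRrM mulVf ?gt_eqF// powRr1.
  rewrite powRM ?expR_ge0 ?ler0n// => h.
  rewrite ler_pdivrMr ?powR_gt0// mulrAC exprVn ler_pdivlMr ?exprn_gt0//.
  by rewrite mulrC -exprMn.
- by apply: is_cvg_geometric_series; rewrite gtr0_norm ?invr_gt0// invf_lt1// ltr1n.
Qed.

(** The shifted terms sum to the partial sum of length n+1 without its first term, which is 1; hence
    the [+ 1]. *)
Lemma series_com_poisson_step lam nu n : nu != 0 ->
  series (fun n => (lam * com_poisson_term lam nu n
                    - com_poisson_term lam nu n.+1) / nu) n =
  (lam * series (com_poisson_term lam nu) n
   - series (com_poisson_term lam nu) n.+1 + 1) / nu.
Proof.
move=> nu0; have u0 : com_poisson_term lam nu 0 = 1.
  by rewrite /com_poisson_term powR1 divr1.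
elim: n => [|n IH].
  by rewrite seriesSr u0 /series/= !big_geq// mulr0; ring.
rewrite seriesSr IH (seriesSr _ n.+1) (seriesSr (com_poisson_term lam nu) n).
by rewrite -mulrDl; congr (_ / _); ring.
Qed.

End com_poisson_series.

(** * The integral, cut at the factorials *)

Section com_poisson_integral.
Context {R : realType} (lam nu : R).
Hypotheses (lam0 : 0 < lam) (nu0 : 0 < nu).
Notation mu := (@lebesgue_measure R).
Let f := fun x : R => x `^ (- (nu + 1)) * lam ^ Num.floor (Gamma_inv x).
(* The point 1 is dropped: convexity of [Gamma], the only tool used to locate
   [Gamma_inv], does not determine [Gamma_inv 1]. *)
Let F n : set R := `[n`!%:R, n.+1`!%:R[%classic `\ 1.

Let f_ge0 x : 0 <= f x.
Proof. by rewrite mulr_ge0 ?powR_ge0// exprz_ge0// ltW. Qed.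

Let measurable_F n : measurable (F n).
Proof. by apply: measurableD. Qed.

(** The exponent is put in the form of [integral_powR] with [p := - nu]. *)
Let fE n x : F n x -> f x = lam ^+ n.+1 * x `^ (- nu - 1).
Proof.
rewrite /F/= in_itv/= => -[/andP[nx xn] /eqP x1].
rewrite /f (@floor_Gamma_inv _ n) ?nx ?xn//.
  by rewrite mulrC opprD.
by rewrite lt_neqAle eq_sym x1 (le_trans _ nx)// ler1n fact_gt0.
Qed.

Let bigcup_F : \bigcup_n F n = `[1, +oo[%classic `\ 1.
Proof.
apply/seteqP; split => x /=.
  move=> [n _]; rewrite /F/= !in_itv/= andbT => -[/andP[nx _] x1]; split => //.
  by rewrite (le_trans _ nx)// ler1n fact_gt0.
rewrite in_itv/= andbT => -[x1 x_neq1].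
have exn : exists n, x < n.+1`!%:R.
  exists (Num.truncn x).+1; apply: lt_le_trans (truncnS_gt x) _.
  rewrite ler_nat; apply: leq_trans (fact_geq _) _.
  by rewrite leq_fact.
(* Minimality of n gives n! <= x, except for n = 0, where this is x >= 1. *)
have [n xn nmin] := ex_minnP exn.
exists n => //; rewrite /F/= in_itv/= xn andbT; split => //.
case: n xn nmin => // n xn nmin; rewrite leNgt; apply/negP => h.
by have := nmin _ h; rewrite ltnn.
Qed.

Let trivIset_F : trivIset setT F.
Proof.
apply: ltn_trivIset => n m mn; apply/seteqP; split => // x [].
rewrite /F/= !in_itv/= => -[/andP[_ xm] _] [/andP[nx _] _].
have : m.+1`!%:R <= n`!%:R :> R by rewrite ler_nat leq_fact.
lra.
Qed.

Let measurable_powRM n (D : set R) :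
  measurable_fun D (fun x : R => (lam ^+ n.+1 * x `^ (- nu - 1))%:E).
Proof.
by apply/measurable_EFinP; apply: measurable_funTS; apply: measurable_funM.
Qed.

(** Measurability is obtained piecewise, without studying [Gamma_inv] itself: on each [F n] the
    function is a multiple of a power. *)
Let measurable_f : measurable_fun (`[1, +oo[%classic `\ 1 : set R) (EFin \o f).
Proof.
rewrite -bigcup_F; apply/measurable_fun_bigcup => // n.
apply: (@eq_measurable_fun _ _ _ _ _ (fun x => (lam ^+ n.+1 * x `^ (- nu - 1))%:E)).
  by move=> x; rewrite inE => Fx /=; rewrite (fE Fx).
exact: measurable_powRM.
Qed.

(** Restoring the null points 1 and (n+1)! gives a closed interval and the integral of a power. For
    n = 0 both sides are 0, because 0! = 1!. *)
Let integral_F n : (\int[mu]_(x in F n) (f x)%:E =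
  ((lam * com_poisson_term lam nu n - com_poisson_term lam nu n.+1) / nu)%:E)%E.
Proof.
transitivity (\int[mu]_(x in F n) (lam ^+ n.+1 * x `^ (- nu - 1))%:E)%E.
  by apply: eq_integral => x; rewrite inE => Fx; rewrite (fE Fx).
rewrite integral_setD1; last 2 first.
- exact: measurable_F.
- exact: measurable_powRM.
rewrite integral_itv_bndo_bndc; last exact: measurable_powRM.
under eq_integral do rewrite EFinM.
have fn k : 0 < (k`!%:R : R) by rewrite ltr0n fact_gt0.
rewrite ge0_integralZl_EFin//=; last 3 first.
- by move=> x _; rewrite lee_fin powR_ge0.
- by apply/measurable_EFinP; apply: measurable_funTS; exact: measurable_powR.
- by rewrite exprn_ge0// ltW.
rewrite integral_powR ?oppr_eq0 ?gt_eqF//; last by rewrite ler_nat leq_fact.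
rewrite -EFinM; congr EFin; rewrite /com_poisson_term !powRN exprS.
field.
by rewrite !gt_eqF ?powR_gt0.
Qed.

Let integral_f : (\int[mu]_(x in `[1%R, +oo[) (f x)%:E =
  ((lam * com_poisson_Z lam nu - com_poisson_Z lam nu + 1) / nu)%:E)%E.
Proof.
rewrite -(integral_setD1 (r := 1)); last 2 first.
- by rewrite -bigcup_F; exact: bigcup_measurable.
- exact: measurable_f.
rewrite -bigcup_F ge0_integral_bigcup//; last 2 first.
- by rewrite bigcup_F; exact: measurable_f.
- by move=> x _; rewrite lee_fin.
under eq_eseriesr do rewrite integral_F.
apply/cvg_lim => //; under eq_fun do rewrite sumEFin.
apply: cvg_EFin; first exact: nearW.
rewrite /comp/=.
have Zc := is_cvg_com_poisson lam0 nu0.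
rewrite (_ : (fun _ => _) = fun n => (lam * series (com_poisson_term lam nu) n
   - series (com_poisson_term lam nu) n.+1 + 1) / nu); last first.
  by apply/funext => n; rewrite -series_com_poisson_step ?gt_eqF.
apply: cvgMr_tmp; apply: cvgD; last exact: cvg_cst.
apply: cvgB; first by apply: cvgMl_tmp; exact: Zc.
(* The shifted partial sums have the same limit [com_poisson_Z lam nu]. *)
by rewrite (cvg_shiftS (series (com_poisson_term lam nu))); exact: Zc.
Qed.

Lemma integrable_com_poisson_integrand : mu.-integrable `[1, +oo[ (EFin \o f).
Proof.
apply/integrableP; split.
  rewrite -(@setD1K _ 1 `[1, +oo[%classic); last by rewrite /= in_itv/= lexx.
  apply/measurable_funU => //; first exact: measurableD.
  by split; [exact: measurable_fun_set1 | exact: measurable_f].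
under eq_integral do rewrite /= ger0_norm//.
by rewrite integral_f ltry.
Qed.

Lemma Rintegral_com_poisson_integrand : \int[mu]_(x in `[1, +oo[) f x =
  (lam * com_poisson_Z lam nu - com_poisson_Z lam nu + 1) / nu.
Proof. by rewrite /Rintegral integral_f. Qed.

End com_poisson_integral.

(** The first two conjuncts certify that the limit and the real-valued integral in the third are
    genuine and not default values. At [lam = 1] both fractions of the formula would have
    denominator zero. *)
Theorem theorem1 (R : realType) (lam nu : R)
  (hlam : 0 < lam) (hnu : 0 < nu) (hlam1 : lam != 1) :
  let f := fun x : R => x `^ (- (nu + 1)) * lam ^ Num.floor (Gamma_inv x) in
  [/\ cvgn (series (com_poisson_term lam nu)),
      (@lebesgue_measure R).-integrable `[1, +oo[ (EFin \o f)
    & com_poisson_Z lam nu =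
      1 / (1 - lam)
      + nu / (lam - 1) * \int[@lebesgue_measure R]_(x in `[1, +oo[) f x].
Proof.
split; first exact: is_cvg_com_poisson.
- exact: integrable_com_poisson_integrand.
(* With I the integral, nu I = (lam - 1) Z + 1 is solved for Z. *)
- rewrite Rintegral_com_poisson_integrand//.
  field.
  by rewrite gt_eqF// !subr_eq0 (eq_sym 1) hlam1.
Qed.
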